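(* Let $(\Omega,\mathcal F,P)$ be a probability space with filtrations $\mathbb F=(\mathcal F_t)_{t\ge0}\subseteq\mathbb G=(\mathcal G_t)_{t\ge0}$ satisfying the usual conditions, and let $X$ be a positive càdlàg $(P,\mathbb G)$-local martingale. Assume there is a sequence $(\tau_n)_{n\in\mathbb N}$ of $\mathbb F$-stopping times increasing to $\infty$ such that each stopped process $X^{\tau_n}$ is a bounded $(P,\mathbb G)$-martingale. Then for every probability measure $Q\sim P$ such that $X$ is a $(Q,\mathbb G)$-local martingale, the $Q$-optional projection ${}^{o,Q}X$ of $X$ into $\mathbb F$ is a $(Q,\mathbb F)$-local martingale.
   Context: For a probability measure $Q\sim P$, the $Q$-optional projection ${}^{o,Q}X$ of $X$ into $\mathbb F$ is the unique càdlàg $\mathbb F$-optional process with $\mathbf 1_{\{\sigma<\infty\}}\,{}^{o,Q}X_\sigma=\mathbb E^Q[\mathbf 1_{\{\sigma<\infty\}}X_\sigma\mid\mathcal F_\sigma]$ a.s. for every $\mathbb F$-stopping time $\sigma$; in particular ${}^{o,Q}X_t=\mathbb E^Q[X_t\mid\mathcal F_t]$. When $Q=P$ it is written ${}^oX$. *)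

(* Defs.v *)
From HB Require Import structures.
From mathcomp Require Import all_boot all_order all_algebra.
From mathcomp Require Import all_classical all_reals all_analysis.
Set Implicit Arguments. Unset Strict Implicit. Unset Printing Implicit Defensive.
Import Order.TTheory GRing.Theory Num.Theory.
Import numFieldNormedType.Exports.
Local Open Scope classical_set_scope.
Local Open Scope ring_scope.

(* Conventions: time set [0, oo) is represented by the reals t with 0 <= t;
   a process is a map  R -> T -> R  (time first); a filtration is a family of
   sets of events  R -> set (set T); random times take values in \bar R. *)

Section Defs.
Context {d : measure_display} {T : measurableType d} {R : realType}.

Definition time := [set t : R | 0 <= t].

Definition meas_wrt (H : set (set T)) (f : T -> R) :=
  forall B : set R, measurable B -> H (f @^-1` B).

Definition filtration (F : R -> set (set T)) :=
  [/\ forall t, time t -> sigma_algebra setT (F t),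
      forall t, time t -> F t `<=` measurable &
      forall s t, 0 <= s -> s <= t -> F s `<=` F t].

Definition usual_conditions (P : probability T R) (F : R -> set (set T)) :=
  filtration F /\
  (forall t, time t -> F t = \bigcap_(s in [set s | t < s]) F s) /\
  (forall A : set T, P.-negligible A -> F 0 A).

Definition adapted (F : R -> set (set T)) (X : R -> T -> R) :=
  forall t, time t -> meas_wrt (F t) (X t).

Definition cadlag (X : R -> T -> R) :=
  forall w, (forall t, time t -> X ^~ w x @[x --> t^'+] --> X t w) /\
            (forall t, 0 < t -> cvg (X ^~ w x @[x --> t^'-])).

Definition stopping_time (F : R -> set (set T)) (sigma : T -> \bar R) :=
  (forall w, (0 <= sigma w)%E) /\
  (forall t, time t -> F t [set w | (sigma w <= t%:E)%E]).

Definition stopped (X : R -> T -> R) (sigma : T -> \bar R) : R -> T -> R :=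
  fun t w => X (if (sigma w < t%:E)%E then fine (sigma w) else t) w.

Definition at_time (X : R -> T -> R) (sigma : T -> \bar R) : T -> R :=
  fun w => if (sigma w < +oo)%E then X (fine (sigma w)) w else 0.

Definition F_infty (F : R -> set (set T)) : set (set T) :=
  smallest (sigma_algebra setT) (\bigcup_(t in time) F t).

Definition F_at (F : R -> set (set T)) (sigma : T -> \bar R) : set (set T) :=
  [set A | F_infty F A /\
     forall t, time t -> F t (A `&` [set w | (sigma w <= t%:E)%E])].

Definition martingale (Q : probability T R) (F : R -> set (set T))
    (X : R -> T -> R) :=
  [/\ adapted F X,
      forall t, time t -> Q.-integrable setT (EFin \o X t) &
      forall s t, 0 <= s -> s <= t -> forall A, F s A ->
        (\int[Q]_(w in A) (X t w)%:E = \int[Q]_(w in A) (X s w)%:E)%E].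

Definition local_martingale (Q : probability T R) (F : R -> set (set T))
    (X : R -> T -> R) :=
  exists tau : nat -> T -> \bar R,
    [/\ forall n, stopping_time F (tau n),
        forall w n, (tau n w <= tau n.+1 w)%E,
        {ae Q, forall w, tau ^~ w @ \oo --> +oo%E} &
        forall n, martingale Q F (stopped X (tau n))].

Definition equiv_meas (Q P : probability T R) :=
  forall A, measurable A -> (P A = 0%E <-> Q A = 0%E).

Definition cond_exp_nonneg (Q : probability T R) (H : set (set T))
    (Z W : T -> R) :=
  [/\ meas_wrt H W, forall w, 0 <= W w &
      forall A, H A ->
        (\int[Q]_(w in A) (W w)%:E = \int[Q]_(w in A) (Z w)%:E)%E].

Definition optional_sets (F : R -> set (set T)) : set (set (T * R)) :=
  smallest (sigma_algebra (setT `*` time))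
    [set [set p : T * R | time p.2 /\ (sigma p.1 <= p.2%:E)%E]
       | sigma in stopping_time F].

Definition optional (F : R -> set (set T)) (Y : R -> T -> R) :=
  forall B : set R, measurable B ->
    optional_sets F [set p : T * R | time p.2 /\ B (Y p.2 p.1)].

Definition optional_projection (Q : probability T R) (F : R -> set (set T))
    (X Y : R -> T -> R) :=
  [/\ cadlag Y, optional F Y &
      forall sigma, stopping_time F sigma ->
        exists W, cond_exp_nonneg Q (F_at F sigma) (at_time X sigma) W /\
          {ae Q, forall w, at_time Y sigma w = W w}].

End Defs.

(* Main.v *)
Require Import Defs.
From HB Require Import structures.
From mathcomp Require Import all_boot all_order all_algebra.
From mathcomp Require Import all_classical all_reals all_analysis.
From mathcomp Require Import measurable_realfun lra.
Import Order.TTheory GRing.Theory Num.Theory.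
Import numFieldNormedType.Exports.
Local Open Scope classical_set_scope.
Local Open Scope ring_scope.

(** The sequence [tau n] localizes the projection. Under [Q], stopping the
    localizing martingales [X^(sigma k)] at [tau n] and letting [k] grow shows,
    by bounded convergence, that [X^(tau n)] is a [(Q, G)]-martingale. For
    [A] in [F s], split along [tau n <= s], where [Y^(tau n)] is already frozen,
    and [s < tau n], which meets [A] in an event of [F] at the times
    [s `min` tau n] and [t `min` tau n]; there the integrals of [Y^(tau n)] are
    those of [X^(tau n)]. *)

(** * Closure of a sigma-algebra under finite operations *)

Section SigmaAlgebra.
Context {T : Type} {S : set (set T)}.
Hypothesis hS : sigma_algebra setT S.

Lemma sigma_algebra_setC A : S A -> S (~` A).
Proof. by case: hS => _ SD _ /SD; rewrite setTD. Qed.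

Lemma sigma_algebra_setU A B : S A -> S B -> S (A `|` B).
Proof.
case: hS => _ _ SU SA SB; rewrite -bigcup2E; apply: SU => -[|[|n]] //=.
by case: hS.
Qed.

Lemma sigma_algebra_setI A B : S A -> S B -> S (A `&` B).
Proof.
move=> SA SB; rewrite -(setCK (A `&` B)) setCI; apply: sigma_algebra_setC.
by apply: sigma_algebra_setU; apply: sigma_algebra_setC.
Qed.

End SigmaAlgebra.

(** * Right limits along sequences, and approximation of capped times from above on a grid *)

Section RightLimits.
Context {R : realType}.

(** The filter [p^'+] leaves out [p], whereas [u] may take the value [p]; there the difference
    vanishes. *)
Lemma cvg_at_right_seq (f : R -> R) (p : R) (u : nat -> R) :
  f x @[x --> p^'+] --> f p -> (forall n, p <= u n) -> u @ \oo --> p ->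
  f (u n) @[n --> \oo] --> f p.
Proof.
move=> fp pu up; apply/cvgrPdist_lt => e e0.
move/cvgrPdist_lt : fp => /(_ _ e0) fp.
have /filterS : \forall n \near \oo, p < u n -> `|f p - f (u n)| < e
  by exact: (up [set t | p < t -> `|f p - f t| < e] fp).
apply=> n /= H.
have := pu n; rewrite le_eqVlt => /orP[/eqP <-|/H//].
by rewrite subrr normr0.
Qed.

(** For [0 <= a], the minimum of [a] and [t] as a real number. The body is the one in [stopped], so
    [stopped X tau t w] is convertible to [X (capped (tau w) t) w]. *)
Definition capped (a : \bar R) (t : R) : R :=
  if (a < t%:E)%E then fine a else t.

(** The first of [u], [u + h], ..., [u + h *+ n] that is at least [a], or the last of them if none
    is. Recursion on the starting point lets an induction split first on the event [tau <= u], which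
    is known at time [u]. *)
Fixpoint grid_time (a : \bar R) (h : R) (n : nat) (u : R) : R :=
  if n is n'.+1 then if (a <= u%:E)%E then u else grid_time a h n' (u + h)
  else u.

Lemma capped_le a t : (0 <= a)%E -> capped a t <= t.
Proof. by case: a => [a|//|//] a0; rewrite /capped ?lte_fin /=; case: ifPn; [exact: ltW|]. Qed.

Lemma capped_ge0 a t : (0 <= a)%E -> 0 <= t -> 0 <= capped a t.
Proof. by case: a => [a|//|//]; rewrite /capped ?lte_fin ?lee_fin /=; case: ifPn. Qed.

Lemma capped_id a t : (t%:E <= a)%E -> capped a t = t.
Proof. by rewrite /capped ltNge => ->. Qed.

Lemma capped_const a s t : (a <= s%:E)%E -> s <= t -> capped a s = capped a t.
Proof.
case: a => [a|//|_ _]; last by rewrite /capped !ltNyr.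
by rewrite /capped !lte_fin lee_fin /= => as_ st; case: ltP => ?; case: ltP => ?; lra.
Qed.

(** The two bounds squeeze [capped a] along times tending to [s] from above, which carries
    right-continuity over to stopped paths. *)
Lemma capped_lipschitz a s t : (0 <= a)%E -> s <= t ->
  capped a s <= capped a t <= capped a s + (t - s).
Proof.
case: a => [a|_|//]; last by rewrite !capped_id ?leey// => st; apply/andP; split; lra.
move=> _ st; rewrite /capped !lte_fin /=.
by apply/andP; split; case: ltP => ?; case: ltP => ?; lra.
Qed.

(** Both sides are the minimum of [a], [b] and [t]: two stoppings may be exchanged, so a bound on a
    process stopped at one time survives stopping at the other. *)
Lemma cappedC a b t : (0 <= a)%E -> (0 <= b)%E ->
  capped a (capped b t) = capped b (capped a t).
Proof.
case: a => [a||//]; last by rewrite !(@capped_id +oo%E) ?leey.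
case: b => [b||//]; last by rewrite !(@capped_id +oo%E) ?leey.
rewrite /capped !lte_fin /= => _ _; case: (ltP a t) => ?; case: (ltP b t) => ?.
- by case: ltP => ?; case: ltP => ?; lra.
- by do !case: ltP => ?; lra.
- by do !case: ltP => ?; lra.
by do !case: ltP => ?; lra.
Qed.

Lemma grid_time_ge a h n u : 0 <= h -> u <= grid_time a h n u.
Proof.
move=> h0; elim: n u => [//|n IH] u /=; case: ifPn => // _.
by apply: le_trans (IH _); rewrite lerDl.
Qed.

(** The hypothesis [u - h < a] is the induction invariant: the search reaches [u] only when the
    preceding grid point lies below [a], so a search that ends at [u] overshoots by at most [h]. *)
Lemma grid_time_capped a h n u : (0 <= a)%E -> 0 <= h -> ((u - h)%:E < a)%E ->
  capped a (u + h *+ n) <= grid_time a h n u <= capped a (u + h *+ n) + h.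
Proof.
move=> a0 h0; elim: n u => [|n IH] u ua.
  rewrite mulr0n addr0 /= capped_le//=.
  case: a ua a0 => [a||//]; rewrite /capped => ua _.
    by move: ua; rewrite !lte_fin /= => ua; case: ltP => ?; lra.
  by rewrite ltNge leey /= lerDl.
rewrite /=; case: ifPn => [au|]; last first.
  by rewrite -ltNge mulrS addrA => au; apply: IH; rewrite addrK.
have hn : 0 <= h *+ n.+1 by rewrite mulrn_wge0.
rewrite -(@capped_const a u) // ?lerDl // capped_le //=.
case: a {IH} ua a0 au => [a|//|//]; rewrite /capped !lte_fin !lee_fin /= => ? ? ?.
by case: ltP => ?; lra.
Qed.

End RightLimits.

(** * Optional stopping of nonnegative right-continuous martingales *)

Section OptionalStopping.
Context {d : measure_display} {T : measurableType d} {R : realType}.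
Implicit Types (Q : probability T R) (F G : R -> set (set T)).
Implicit Types (tau : T -> \bar R) (M X : R -> T -> R).

Lemma filtration_measurable G (t : R) A : filtration G -> 0 <= t -> G t A ->
  measurable A.
Proof. by case=> _ sub _ t0; apply: sub. Qed.

Lemma filtrationW G (s t : R) A : filtration G -> 0 <= s -> s <= t -> G s A -> G t A.
Proof. by case=> _ _ mono s0 st; apply: mono. Qed.

Lemma stopping_time_gt G tau (t : R) : filtration G -> stopping_time G tau ->
  0 <= t -> G t [set w | (t%:E < tau w)%E].
Proof.
move=> [sG _ _] [_ tauG] t0.
rewrite (_ : [set _ | _] = ~` [set w | (tau w <= t%:E)%E]).
  exact: (sigma_algebra_setC (sG _ t0)) (tauG _ t0).
by apply/seteqP; split => w /=; rewrite ltNge => /negP.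
Qed.

Lemma meas_wrt_measurable_fun G (t : R) (f : T -> R) : filtration G -> 0 <= t ->
  meas_wrt (G t) f -> measurable_fun setT f.
Proof.
move=> fG t0 mf _ B mB; rewrite setTI.
exact: filtration_measurable fG t0 (mf B mB).
Qed.

Lemma measurable_grid_time G tau (f : R -> T -> \bar R) (h : R) (n : nat) (u : R) :
  filtration G -> stopping_time G tau ->
  (forall v, 0 <= v -> measurable_fun setT (f v)) -> 0 <= u -> 0 <= h ->
  measurable_fun setT (fun w => f (grid_time (tau w) h n u) w).
Proof.
move=> fG [tau0 tauG] mf; elim: n u => [|n IH] u u0 h0 /=; first exact: mf.
rewrite (_ : (fun w => _) = fun w => if (tau w <= u%:E)%E then f u w
    else f (grid_time (tau w) h n (u + h)%R) w); last first.
  by apply/funext => w; case: ifP.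
apply: measurable_fun_ifT; [|exact: mf|by apply: IH => //; exact: addr_ge0].
apply: (measurable_fun_bool true); rewrite setTI.
exact: (filtration_measurable _ u) (tauG _ u0).
Qed.

(* [op] is [=] for a martingale and [<=] or [>=] for a sub- or supermartingale. *)
Lemma integral_grid_time Q G tau (f : R -> T -> \bar R)
    (op : \bar R -> \bar R -> Prop) (h : R) (n : nat) (u : R) B :
  (forall x, op x x) ->
  (forall x y x' y', op x y -> op x' y' -> op (x + x')%E (y + y')%E) ->
  filtration G -> stopping_time G tau ->
  (forall v, 0 <= v -> measurable_fun setT (f v)) ->
  (forall v w, 0 <= v -> (0 <= f v w)%E) ->
  (forall v v' A, 0 <= v -> v <= v' -> G v A ->
     op (\int[Q]_(w in A) f v w)%E (\int[Q]_(w in A) f v' w)%E) ->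
  0 <= u -> 0 <= h -> G u B ->
  op (\int[Q]_(w in B) f (grid_time (tau w) h n u) w)%E
     (\int[Q]_(w in B) f (u + h *+ n)%R w)%E.
Proof.
move=> op_refl opD fG sG mf f0 fmart u0 h0.
have [tau0 tauG] := sG; have [saG _ _] := fG.
elim: n u u0 B => [|n IH] u u0 B GB; first by rewrite mulr0n addr0; exact: op_refl.
(* On [B1] the search ends at [u], and the hypothesis on [f] compares [u] with the last grid point.
   On [B2], an event of [G u], the search restarts at [u + h] and the induction hypothesis
   applies. *)
pose B1 := B `&` [set w | (tau w <= u%:E)%E].
pose B2 := B `&` [set w | (u%:E < tau w)%E].
have GB1 : G u B1 by apply: (sigma_algebra_setI (saG _ u0)) (tauG _ u0).
have GB2 : G u B2.
  by apply: (sigma_algebra_setI (saG _ u0)) => //; apply: stopping_time_gt.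
have mB1 := filtration_measurable _ _ _ fG u0 GB1.
have mB2 := filtration_measurable _ _ _ fG u0 GB2.
have BE : B = B1 `|` B2.
  apply/seteqP; split => [w Bw|w [[]//|[]//]].
  by have [?|?] := leP (tau w) u%:E; [left|right].
have disj : [disjoint B1 & B2].
  by apply/disj_setPS => w [[_ /= a] [_ /=]]; rewrite ltNge a.
have un0 : 0 <= u + h *+ n.+1 by rewrite addr_ge0// mulrn_wge0.
have mfu D v : 0 <= v -> measurable_fun D (f v).
  by move=> v0; apply: measurable_funTS; exact: mf.
have mfg D : measurable_fun D (fun w => f (grid_time (tau w) h n.+1 u) w).
  by apply: measurable_funTS; apply: measurable_grid_time fG sG mf _ _.
have fg0 w : (0 <= f (grid_time (tau w) h n.+1 u) w)%E.
  by apply: f0; apply: le_trans (grid_time_ge _ _ _ _ _).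
rewrite BE !ge0_integral_setU//; last 2 first.
- exact: mfu.
- by move=> w _; exact: f0.
apply: opD.
- rewrite (eq_integral (f u)).
    by apply: fmart => //; rewrite lerDl mulrn_wge0.
  by move=> w; rewrite inE /= => -[_ /= ->].
rewrite (eq_integral (fun w => f (grid_time (tau w) h n (u + h)%R) w)).
  rewrite mulrS addrA; apply: IH; first exact: addr_ge0.
  by apply: (filtrationW _ u) => //; rewrite lerDl.
by move=> w; rewrite inE /= => -[_ /=]; rewrite ltNge => /negbTE ->.
Qed.

(** Monotone convergence: at each point the truncations increase and equal [f x] from some index
    on. *)
Lemma cvg_integral_minr Q (D : set T) (f : T -> R) : measurable D ->
  measurable_fun D f -> (forall x, D x -> 0 <= f x) ->
  (\int[Q]_(x in D) (Num.min (f x) n%:R)%:E)%E @[n --> \oo] -->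
  (\int[Q]_(x in D) (f x)%:E)%E.
Proof.
move=> mD mf f0.
rewrite (eq_integral (fun x => limn (fun n => (Num.min (f x) n%:R)%:E))).
  apply: cvg_monotone_convergence => //.
  - move=> n; apply/measurable_EFinP.
    by apply: measurable_minr => //; exact: measurable_cst.
  - by move=> n x Dx; rewrite lee_fin le_min f0//=.
  - move=> x Dx m n mn; rewrite lee_fin le_min ge_min lexx/=.
    by rewrite ge_min ler_nat mn orbT.
move=> x; rewrite inE => Dx; apply/esym/cvg_lim => //.
apply: cvg_near_cst; exists (Num.truncn (f x)).+1 => // n /= fn.
congr _%:E; apply/min_idPl; apply: ltW.
apply: lt_le_trans (truncnS_gt _) _.
by rewrite ler_nat.
Qed.

(** Conditional Jensen for the concave map [x |-> Num.min x c], done by hand. Where [M s <= c],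
    truncation at time [s] changes nothing and the martingale property applies; elsewhere the
    truncated value at [s] is [c], the largest possible. *)
Lemma martingale_minr Q G M (c s t : R) A : filtration G -> martingale Q G M ->
  (forall v w, 0 <= v -> 0 <= M v w) -> 0 <= c -> 0 <= s -> s <= t -> G s A ->
  (\int[Q]_(w in A) (Num.min (M s w) c)%:E >=
   \int[Q]_(w in A) (Num.min (M t w) c)%:E)%E.
Proof.
move=> fG [aM iM mM] M0 c0 s0 st GA; have t0 := le_trans s0 st.
have [saG _ _] := fG.
have mMv v : 0 <= v -> measurable_fun setT (M v).
  by move=> v0; apply: (meas_wrt_measurable_fun G v) => //; exact: aM.
have GMs : G s [set w | M s w <= c].
  have := aM s s0 [set` `]-oo, c]] (measurable_itv _).
  by rewrite (_ : _ @^-1` _ = [set w | M s w <= c]).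
pose A1 := A `&` [set w | M s w <= c].
pose A2 := A `&` ~` [set w | M s w <= c].
have GA1 : G s A1 by apply: (sigma_algebra_setI (saG _ s0)).
have GA2 : G s A2.
  by apply: (sigma_algebra_setI (saG _ s0)) => //; apply: (sigma_algebra_setC (saG _ s0)).
have mA1 := filtration_measurable _ _ _ fG s0 GA1.
have mA2 := filtration_measurable _ _ _ fG s0 GA2.
have AE : A = A1 `|` A2 by rewrite -setIUr setUCr setIT.
have disj : [disjoint A1 & A2] by apply/disj_setPS => w [[_ a] [_ ]].
have mmin D v : 0 <= v -> measurable_fun D (fun w => (Num.min (M v w) c)%:E).
  move=> v0; apply: measurable_funTS; apply/measurable_EFinP.
  by apply: measurable_minr; [exact: mMv|exact: measurable_cst].
have min0 v w : 0 <= v -> (0 <= (Num.min (M v w) c)%:E)%E.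
  by move=> v0; rewrite lee_fin le_min M0.
rewrite AE !ge0_integral_setU//; try by [move=> ? ?; exact: min0|exact: mmin].
apply: leeD.
- rewrite [in X in (_ <= X)%E](eq_integral (EFin \o M s)); last first.
    by move=> w; rewrite inE => -[_ /= Mc]; rewrite /= min_l.
  rewrite -(mM s t)//; apply: ge0_le_integral => //.
  + by move=> w _; exact: min0.
  + exact: mmin.
  + by apply: measurable_funTS; apply/measurable_EFinP; exact: mMv.
  + by move=> w _; rewrite lee_fin ge_min lexx.
- apply: ge0_le_integral => //.
  + by move=> w _; exact: min0.
  + exact: mmin.
  + exact: mmin.
  + move=> w [_ /= /negP]; rewrite -ltNge => Mc.
    by rewrite lee_fin (min_r (ltW Mc)) ge_min lexx orbT.
Qed.

(* The truncation at [c] replaces uniform integrability: it makes the passage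
   from the grid to [tau] dominated, at the cost of two inequalities. *)
Lemma optional_stopping Q G M tau (s t : R) B :
  filtration G -> stopping_time G tau -> martingale Q G M ->
  (forall v w, 0 <= v -> 0 <= M v w) ->
  (forall v w, 0 <= v -> M ^~ w x @[x --> v^'+] --> M v w) ->
  0 <= s -> s <= t -> G s B -> B `<=` [set w | (s%:E < tau w)%E] ->
  measurable_fun B (stopped M tau t) /\
  (\int[Q]_(w in B) (stopped M tau t w)%:E = \int[Q]_(w in B) (M s w)%:E)%E.
Proof.
move=> fG sG martM M0 Mcts s0 st GB Btau; have t0 := le_trans s0 st.
have [tau0 tauG] := sG; have [aM iM mM] := martM.
have mB := filtration_measurable _ _ _ fG s0 GB.
pose h m : R := (t - s) / m.+1%:R.
have h0 m : 0 <= h m by rewrite divr_ge0 ?subr_ge0.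
have hE m : s + h m *+ m.+1 = t.
  by rewrite -mulr_natr divfK ?pnatr_eq0// addrC subrK.
pose rho m w := grid_time (tau w) (h m) m.+1 s.
have rhoB m w : 0 <= rho m w.
  by apply: le_trans s0 _; exact: grid_time_ge.
have mMv v : 0 <= v -> measurable_fun setT (M v).
  by move=> v0; apply: (meas_wrt_measurable_fun G v) => //; exact: aM.
have mMrho m : measurable_fun setT (fun w => M (rho m w) w).
  apply/measurable_EFinP.
  apply: (@measurable_grid_time G tau (fun v w => (M v w)%:E)) => // v v0.
  by apply/measurable_EFinP; exact: mMv.
have cap0 w : 0 <= capped (tau w) t by exact: capped_ge0.
(* The grid times approach [capped (tau w) t] from above, so right-continuity suffices. On [B] the
   strict inequality [s < tau] supplies the invariant of [grid_time_capped], even when [s = t] and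
   the mesh is zero. *)
have cvg w : B w -> M (rho m w) w @[m --> \oo] --> M (capped (tau w) t) w.
  move=> Bw; have tw : (s%:E < tau w)%E := Btau _ Bw.
  have rhoP m : capped (tau w) t <= rho m w <= capped (tau w) t + h m.
    rewrite -[in X in X <= _ <= _](hE m) -[in X in _ <= _ <= X + _](hE m).
    apply: grid_time_capped => //; apply: le_lt_trans tw.
    by rewrite lee_fin gerBl.
  apply: (cvg_at_right_seq (M ^~ w)); first exact: Mcts.
    by move=> m; case/andP: (rhoP m).
  have hcvg : h m @[m --> \oo] --> (0 : R).
    rewrite -[X in _ --> X](mulr0 (t - s)); apply: cvgM; first exact: cvg_cst.
    exact: cvg_harmonic.
  apply: (@squeeze_cvgr _ _ _ _ (fun=> capped (tau w) t) (fun m => capped (tau w) t + h m)).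
  - by near=> m; exact: rhoP.
  - exact: cvg_cst.
  - by rewrite -[X in _ --> X]addr0; apply: cvgD => //; exact: cvg_cst.
have mMtau : measurable_fun B (stopped M tau t).
  apply: (@measurable_fun_cvg _ _ _ _ (fun m w => M (rho m w) w)) => //.
  by move=> m; apply: measurable_funTS; exact: mMrho.
split => //.
(* At a fixed level [c] the constant [c] dominates, so the limit along the grids passes under the
   integral. *)
have trunc c : 0 <= c ->
    (\int[Q]_(w in B) (Num.min (M (rho m w) w) c)%:E)%E @[m --> \oo] -->
    (\int[Q]_(w in B) (Num.min (stopped M tau t w) c)%:E)%E.
  move=> c0; apply: (@dominated_cvg _ _ _ _ _ mB _ _ (cst c%:E)) => //.
  - move=> m; apply: measurable_funTS; apply/measurable_EFinP.
    by apply: measurable_minr; [exact: mMrho|exact: measurable_cst].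
  - move=> w Bw; apply: cvg_EFin; first by near=> m.
    rewrite /comp /= minr_absE; under eq_fun do rewrite minr_absE.
    have cvgw : M (rho m w) w @[m --> \oo] --> stopped M tau t w by exact: cvg.
    have cvgc : (fun _ : nat => c) @ \oo --> c by exact: cvg_cst.
    apply: cvgM; last exact: cvg_cst.
    by apply: cvgB; [exact: cvgD|apply: cvg_norm; exact: cvgB].
  - exact: finite_measure_integrable_cst.
  - move=> m w Bw; rewrite lee_fin ger0_norm ?ge_min ?lexx ?orbT//.
    by rewrite le_min M0.
(* Along the grid the martingale identity is exact; for the truncated process only the
   supermartingale inequality remains. *)
have upper m : (\int[Q]_(w in B) (M (rho m w) w)%:E = \int[Q]_(w in B) (M t w)%:E)%E.
  rewrite -(hE m).
  apply: (@integral_grid_time Q G tau (fun v w => (M v w)%:E) eq) => //.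
  - by move=> ? ? ? ? -> ->.
  - by move=> v v0; apply/measurable_EFinP; exact: mMv.
  - by move=> v v' A v0 vv' GA /=; rewrite (mM v v').
have lower m c : 0 <= c -> (\int[Q]_(w in B) (Num.min (M t w) c)%:E <=
    \int[Q]_(w in B) (Num.min (M (rho m w) w) c)%:E)%E.
  move=> c0; rewrite -[in X in (X <= _)%E](hE m).
  apply: (@integral_grid_time Q G tau (fun v w => (Num.min (M v w) c)%:E)
    (fun x y => (y <= x)%E)) => //.
  - by move=> ? ? ? ?; exact: leeD.
  - move=> v v0; apply/measurable_EFinP.
    by apply: measurable_minr; [exact: mMv|exact: measurable_cst].
  - by move=> v w v0; rewrite /= lee_fin le_min M0.
  - by move=> v v' A v0 vv' GA; apply: (@martingale_minr Q G).
have cM w : B w -> 0 <= M t w by move=> _; exact: M0.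
have cS w : B w -> 0 <= stopped M tau t w by move=> _; exact: (M0 _ w (cap0 w)).
have mMt : measurable_fun B (M t) by apply: measurable_funTS; exact: mMv.
(* Each inequality takes the grid limit at a fixed level [n] and then lets [n] grow. The first
   bounds the truncation by the untruncated [M] and uses [upper]; the second compares truncations by
   [lower]. *)
rewrite -(mM s t)//; apply/eqP; rewrite eq_le; apply/andP; split.
- apply: (@lee_cvg_to _ _ _ _ _ (fun=> _) _ _
    (cvg_integral_minr Q B _ mB mMtau cS)); first exact: cvg_cst.
  near=> n; apply: (@lee_cvg_to _ _ _ _ _ (fun=> _) _ _
    (trunc n%:R (ler0n _ _))); first exact: cvg_cst.
  near=> m; rewrite -(upper m); apply: ge0_le_integral => //.
  + by move=> w _; rewrite lee_fin le_min M0 /=.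
  + apply: measurable_funTS; apply/measurable_EFinP.
    by apply: measurable_minr; [exact: mMrho|exact: measurable_cst].
  + by apply: measurable_funTS; apply/measurable_EFinP; exact: mMrho.
  + by move=> w _; rewrite lee_fin ge_min lexx.
- apply: (lee_cvg_to (cvg_integral_minr Q B _ mB mMt cM)
    (cvg_integral_minr Q B _ mB mMtau cS)).
  near=> n; apply: (@lee_cvg_to _ _ _ _ (fun=> _) _ _ _ _
    (trunc n%:R (ler0n _ _))); first exact: cvg_cst.
  by near=> m; apply: lower.
Unshelve. all: by end_near. Qed.

End OptionalStopping.

(** * Stopped processes: right-continuity, adaptedness, and bounded stopped local martingales *)

Section StoppedProcesses.
Context {d : measure_display} {T : measurableType d} {R : realType}.
Implicit Types (P Q : probability T R) (F G : R -> set (set T)).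
Implicit Types (sigma tau : T -> \bar R) (X Y : R -> T -> R).

Lemma stopped_right_continuous X sigma (t : R) w : cadlag X ->
  (0 <= sigma w)%E -> 0 <= t ->
  stopped X sigma ^~ w x @[x --> t^'+] --> stopped X sigma t w.
Proof.
move=> cX s0 t0; apply/cvg_at_rightP => u [tu ut].
apply: (cvg_at_right_seq (X ^~ w) (capped (sigma w) t)
  (fun n => capped (sigma w) (u n))).
- by apply: (cX w).1; exact: capped_ge0.
- by move=> n; case/andP: (capped_lipschitz _ _ _ s0 (ltW (tu n))).
- apply: (@squeeze_cvgr _ _ _ _ (fun=> capped (sigma w) t)
    (fun n => capped (sigma w) t + (u n - t))).
  + by near=> n; apply: capped_lipschitz => //; exact: ltW.
  + exact: cvg_cst.
  + rewrite -[X in _ --> X]addr0 -(subrr t); apply: cvgD; first exact: cvg_cst.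
    by apply: cvgB => //; exact: cvg_cst.
Unshelve. all: by end_near. Qed.

(* [{sigma <= t} `&` {tau < sigma}] is detected by a rational time in [0, t[ *)
Lemma stopping_time_le_capped F sigma tau (t : R) : filtration F ->
  stopping_time F sigma -> stopping_time F tau -> 0 <= t ->
  F t [set w | (sigma w <= (capped (tau w) t)%:E)%E].
Proof.
move=> fF sS sT t0; have [sigma0 sigmaF] := sS; have [tau0 tauF] := sT.
have [saF _ _] := fF; have saFt := saF _ t0; have [F0 _ FU] := saFt.
(* [E q] is the event [tau <= q < sigma], known at time [q <= t]. The rationals are enumerated
   through [unpickle] to obtain a union indexed by [nat]. *)
pose E (q : rat) : set T := if (0 <= ratr q :> R) && (ratr q <= t :> R)
  then [set w | (tau w <= (ratr q)%:E)%E] `&` [set w | ((ratr q)%:E < sigma w)%E]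
  else set0.
pose E' (k : nat) : set T := if (unpickle k : option rat) is Some q then E q else set0.
have FE q : F t (E q).
  rewrite /E; case: ifPn => [/andP[q0 qt]|_ //].
  apply: (filtrationW _ _ _ _ fF q0 qt); apply: (sigma_algebra_setI (saF _ q0)).
    exact: tauF.
  exact: stopping_time_gt.
have FE' : F t (\bigcup_k E' k).
  by apply: FU => k; rewrite /E'; case: unpickle.
rewrite (_ : [set _ | _] = [set w | (sigma w <= t%:E)%E] `&` ~` (\bigcup_k E' k)).
  apply: (sigma_algebra_setI saFt); first exact: sigmaF.
  exact: (sigma_algebra_setC saFt).
apply/seteqP; split => w /=.
- move=> sw; split.
    by apply: le_trans sw _; rewrite lee_fin capped_le.
  move=> [k _]; rewrite /E'; case: unpickle => // q; rewrite /E.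
  case: ifPn => // /andP[q0 qt] [/= tq qs].
  have := lt_le_trans qs sw; rewrite -(capped_const _ _ _ tq qt) lte_fin ltNge.
  by rewrite capped_le.
(* If [sigma <= t] exceeds the capped time, then [tau < t], both times are finite, and a rational
   lies strictly between them. *)
- move=> [st nE]; rewrite leNgt; apply/negP => cs; apply: nE.
  have tt : (tau w < t%:E)%E.
    rewrite ltNge; apply/negP => tw.
    by move: cs; rewrite capped_id// ltNge st.
  have sf : sigma w \is a fin_num.
    by rewrite ge0_fin_numE// (le_lt_trans st)// ltry.
  have tf : tau w \is a fin_num.
    by rewrite ge0_fin_numE// (lt_trans tt)// ltry.
  have : fine (tau w) < fine (sigma w).
    by move: cs; rewrite /capped tt -[sigma w in X in X -> _](fineK sf) lte_fin.
  move=> /rat_in_itvoo[q]; rewrite in_itv/= => /andP[tq qs].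
  exists (pickle q); first exact: I.
  rewrite /E' pickleK /E.
  have -> : 0 <= ratr q :> R by apply: le_trans (ltW tq); exact: fine_ge0.
  have -> : ratr q <= t :> R.
    apply: (le_trans (ltW qs)); rewrite -lee_fin fineK//.
  split => /=; first by rewrite -[tau w](fineK tf) lee_fin ltW.
  by rewrite -[sigma w](fineK sf) lte_fin.
Qed.

(** The sets whose section along [w |-> (w, capped (tau w) t)] lies in [F t] form a sigma-algebra.
    The section of the generator given by a stopping time [sigma] is the event of
    [stopping_time_le_capped]. *)
Lemma optional_stopped_adapted F Y tau : filtration F -> stopping_time F tau ->
  optional F Y -> adapted F (stopped Y tau).
Proof.
move=> fF sT oY t t0 B mB; have [tau0 tauF] := sT; have [saF _ _] := fF.
have [F0 FD FU] := saF _ t0.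
pose section D := [set w | D (w, capped (tau w) t)] : set T.
have cap0 w : time (capped (tau w) t) by exact: capped_ge0.
have : optional_sets F `<=` [set D | F t (section D)].
  apply: smallest_sub.
    split => /=.
    - by rewrite (_ : section set0 = set0).
    - move=> D FtD; rewrite (_ : section _ = setT `\` section D); first exact: FD.
      by apply/seteqP; split => w /=; move=> [_ nD]; split => //; split => //; exact: cap0.
    - move=> D FtD; rewrite (_ : section _ = \bigcup_k section (D k)); first exact: FU.
      by apply/seteqP; split => w [k _ Dk]; exists k.
  move=> D [sigma sS <-] /=.
  rewrite (_ : section _ = [set w | (sigma w <= (capped (tau w) t)%:E)%E]).
    exact: stopping_time_le_capped.
  by apply/seteqP; split => w /=; [case|move=> ?; split=> //; exact: cap0].
move=> /(_ _ (oY _ mB)) /=; congr (F t _).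
by apply/seteqP; split => w /=; [case|move=> ?; split=> //; exact: cap0].
Qed.

(** Optional stopping at [tau] gives each [Z k] the same integral over [B] at every time [r >= s],
    namely that of [Z k s]. As [k] grows, this one sequence converges to the integral of
    [stopped X tau r] for [r = s] and for [r = t], so the two limits agree. *)
Lemma bounded_stopped_local_martingale Q G X tau (C s t : R) B :
  filtration G -> stopping_time G tau -> cadlag X ->
  (forall v w, 0 <= v -> 0 <= X v w) -> local_martingale Q G X ->
  (forall v, 0 <= v -> measurable_fun setT (stopped X tau v)) ->
  {ae Q, forall w, forall v, time v -> `|stopped X tau v w| <= C} ->
  0 <= s -> s <= t -> G s B -> B `<=` [set w | (s%:E < tau w)%E] ->
  (\int[Q]_(w in B) (stopped X tau t w)%:E =
   \int[Q]_(w in B) (stopped X tau s w)%:E)%E.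
Proof.
move=> fG sT cX X0 [sigma [sS _ sigmaoo martX]] mX bX s0 st GB Btau.
have [tau0 _] := sT; have mB := filtration_measurable _ _ _ fG s0 GB.
pose Z k := stopped X (sigma k).
have os k r : s <= r -> measurable_fun B (stopped (Z k) tau r) /\
    (\int[Q]_(w in B) (stopped (Z k) tau r w)%:E = \int[Q]_(w in B) (Z k s w)%:E)%E.
  move=> sr; have [sk0 _] := sS k.
  apply: (optional_stopping Q G (Z k) tau s r B fG sT (martX k)) => //.
  - by move=> v w v0; apply: X0; exact: capped_ge0.
  - by move=> v w v0; exact: stopped_right_continuous.
have lim r : s <= r ->
    (\int[Q]_(w in B) (Z k s w)%:E)%E @[k --> \oo] -->
    (\int[Q]_(w in B) (stopped X tau r w)%:E)%E.
  move=> sr; have r0 := le_trans s0 sr.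
  under eq_fun => k do rewrite -(os k r sr).2.
  have [//|||||_ _] := @dominated_convergence _ _ _ Q B mB
    (fun k w => (stopped (Z k) tau r w)%:E) (EFin \o stopped X tau r) (EFin \o cst C).
  - by move=> k; apply/measurable_EFinP; exact: (os k r sr).1.
  - by apply/measurable_EFinP; apply: measurable_funTS; exact: mX.
  (* Almost surely [sigma k] is eventually at least [r], and stopping there then has no effect up to
     [r]. *)
  - apply: filterS sigmaoo => w sw Bw; apply: cvg_near_cst.
    have /cvgeyPge/(_ r) := sw; apply: filterS => k rk.
    rewrite -[LHS]/(X (capped (sigma k w) (capped (tau w) r)) w)%:E.
    rewrite (capped_id (sigma k w))//; apply: le_trans rk.
    by rewrite lee_fin capped_le.
  - exact: finite_measure_integrable_cst.
  (* After the exchange of stoppings this is [X] stopped at [tau], read at the random time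
     [capped (sigma k w) r]; the bound applies because its null set serves all times at once. *)
  - apply: filterS bX => w bw k Bw; rewrite lee_fin.
    have [sk0 _] := sS k.
    rewrite -[stopped _ _ _ _]/(X (capped (sigma k w) (capped (tau w) r)) w).
    by rewrite cappedC//; apply: bw; exact: capped_ge0.
  by [].
exact: (cvg_unique _ (lim t st) (lim s (lexx s))).
Qed.

(** * The projection tested at the minimum of a stopping time and a fixed time *)

Lemma stopping_time_min F tau (t : R) : filtration F -> stopping_time F tau ->
  0 <= t -> stopping_time F (fun w => Order.min (tau w) t%:E).
Proof.
move=> [saF _ _] [tau0 tauF] t0; split=> [w|u u0].
  by rewrite le_min tau0 lee_fin.
have [F0 _ _] := saF _ u0.
have [tu|ut] := leP t u.
  rewrite (_ : [set _ | _] = ~` set0); first exact: (sigma_algebra_setC (saF _ u0)).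
  by apply/seteqP; split => w /= _; [exact|rewrite ge_min !lee_fin tu orbT].
rewrite (_ : [set _ | _] = [set w | (tau w <= u%:E)%E]); first exact: tauF.
by apply/seteqP; split => w /=; rewrite ge_min !lee_fin (leNgt t) ut orbF.
Qed.

(** The minimum with [t] is finite, so the default value in [at_time] never occurs. The projection
    property at this time thus becomes a statement about stopped processes. *)
Lemma at_time_min X tau (t : R) : (forall w, (0 <= tau w)%E) ->
  at_time X (fun w => Order.min (tau w) t%:E) = stopped X tau t.
Proof.
move=> tau0; apply/funext => w; rewrite /at_time /stopped gt_min ltry orbT.
by rewrite /Order.min; case: ifP.
Qed.

Lemma F_at_setT F sigma : filtration F -> stopping_time F sigma ->
  F_at F sigma setT.
Proof.
move=> [saF _ _] [_ sigmaF]; split; last by move=> t t0; rewrite setTI; exact: sigmaF.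
move=> S [saS FS]; apply: FS; exists 0; first exact: lexx.
have [F0 _ _] := saF 0 (lexx _).
by rewrite -setC0; exact: (sigma_algebra_setC (saF 0 (lexx _))).
Qed.

(** On [A] both [tau] and [t] are at least [s]: for [u < s] the trace of [A] is empty, and from [s]
    on [A] itself is known. *)
Lemma F_at_min F tau (s t : R) A : filtration F -> stopping_time F tau ->
  0 <= s -> s <= t -> F s A -> A `<=` [set w | (s%:E < tau w)%E] ->
  F_at F (fun w => Order.min (tau w) t%:E) A.
Proof.
move=> fF sT s0 st FA Atau; have [saF _ _] := fF; split.
  by move=> S [saS FS]; apply: FS; exists s.
move=> u u0; have [su|us] := leP s u.
  apply: (sigma_algebra_setI (saF _ u0)); first exact: filtrationW FA.
  by apply: (stopping_time_min _ _ _ fF sT (le_trans s0 st)).2.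
rewrite (_ : _ `&` _ = set0); first by case: (saF _ u0).
rewrite -subset0 => w [/Atau /= sw].
rewrite ge_min !lee_fin => /orP[tu|tu].
  by have := lt_le_trans sw tu; rewrite lte_fin ltNge (ltW us).
by have := le_lt_trans (le_trans st tu) us; rewrite ltxx.
Qed.

Lemma F_at_measurable F sigma A : filtration F -> F_at F sigma A -> measurable A.
Proof.
move=> [_ mF _] [+ _]; apply: smallest_sub.
  exact: sigma_algebra_measurable.
by move=> B [t t0]; exact: mF.
Qed.

Lemma equiv_meas_ae P Q (E : set T) : equiv_meas Q P ->
  {ae P, forall w, E w} -> {ae Q, forall w, E w}.
Proof. by move=> PQ [N [mN N0 EN]]; exists N; split => //; apply/PQ. Qed.

End StoppedProcesses.

(** * The stopped projection as a martingale under [Q] *)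

Theorem mainTheorem1 (d : measure_display) (T : measurableType d)
  (R : realType) (P : probability T R) (F G : R -> set (set T))
  (X : R -> T -> R) :
  usual_conditions P F -> usual_conditions P G ->
  (forall t, time t -> F t `<=` G t) ->
  cadlag X -> (forall t w, time t -> 0 < X t w) ->
  local_martingale P G X ->
  (exists tau : nat -> T -> \bar R,
     [/\ forall n, stopping_time F (tau n),
         forall w n, (tau n w <= tau n.+1 w)%E,
         {ae P, forall w, tau ^~ w @ \oo --> +oo%E} &
         forall n, martingale P G (stopped X (tau n)) /\
           exists C : R, {ae P, forall w, forall t, time t ->
                                  `|stopped X (tau n) t w| <= C}]) ->
  forall (Q : probability T R), equiv_meas Q P ->
  local_martingale Q G X ->
  forall Y : R -> T -> R, optional_projection Q F X Y ->
  local_martingale Q F Y.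
Proof.
move=> [fF _] [fG _] FG cX Xpos _ [tau [tauF tauS tauoo bX]] Q QP lX Y [_ oY projY].
have PQ : forall E : set T, {ae P, forall w, E w} -> {ae Q, forall w, E w}.
  move=> E; apply: equiv_meas_ae => A mA.
  by have [? ?] := QP A mA; split.
exists tau; split => // [|n]; first exact: PQ.
have {bX} [[aX _ _] [C /PQ bX]] := bX n.
move: (tau n) (tauF n) aX bX => {tauF tauS tauoo} {}tau sT aX bX.
have [tau0 tauF] := sT.
have sTG : stopping_time G tau by split => // t t0; apply: FG => //; exact: tauF.
have X0 v w : 0 <= v -> 0 <= X v w by move=> v0; exact/ltW/Xpos.
have mX v : 0 <= v -> measurable_fun setT (stopped X tau v).
  by move=> v0; apply: (meas_wrt_measurable_fun G v) => //; exact: aX.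
have aY : adapted F (stopped Y tau) by exact: optional_stopped_adapted.
have mY D v : 0 <= v -> measurable_fun D (EFin \o stopped Y tau v).
  move=> v0; apply: measurable_funTS; apply/measurable_EFinP.
  by apply: (meas_wrt_measurable_fun F v) => //; exact: aY.
(* [W] is nonnegative everywhere, while the stopped [Y] agrees with it only almost surely, so
   integrals of [Y] are compared with those of [X] through [W]. *)
have proj t : 0 <= t -> exists W : T -> R, [/\ measurable_fun setT W,
    forall w, 0 <= W w, {ae Q, forall w, stopped Y tau t w = W w} &
    forall A, F_at F (fun w => Order.min (tau w) t%:E) A ->
      (\int[Q]_(w in A) (W w)%:E = \int[Q]_(w in A) (stopped X tau t w)%:E)%E].
  move=> t0; have sTt := stopping_time_min _ _ _ fF sT t0.
  have [W [[mW W0 intW] YW]] := projY _ sTt.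
  exists W; rewrite -!at_time_min//; split => // _ B mB; rewrite setTI.
  exact: F_at_measurable fF (mW B mB).
split => // [t t0|s t s0 st A FA].
- have [W [mW W0 YW intW]] := proj t t0.
  apply/integrableP; split; first exact: mY.
  rewrite (ge0_ae_eq_integral (g := EFin \o W))//.
  + rewrite intW; last exact: F_at_setT (stopping_time_min _ _ _ fF sT t0).
    (* The absolute value of [C] makes the dominating constant visibly nonnegative. *)
    apply: (@le_lt_trans _ _ (\int[Q]_w (EFin \o cst `|C|%R) w)%E).
      apply: ae_ge0_le_integral => //.
      * by move=> w _; rewrite lee_fin; apply: X0; exact: capped_ge0.
      * by apply/measurable_EFinP; exact: mX.
      * by move=> w _; rewrite lee_fin normr_ge0.
      * by apply/measurable_EFinP; exact: measurable_cst.
      * apply: filterS bX => w bw _; rewrite lee_fin.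
        apply: le_trans (ler_norm _) _; apply: le_trans (ler_norm _).
        exact: bw.
    have /integrableP[_] := finite_measure_integrable_cst Q `|C| measurableT.
    by under eq_integral do rewrite /= normr_id.
  + by apply: measurableT_comp => //; exact: mY.
  + exact/measurable_EFinP.
  + by move=> w _; rewrite lee_fin.
  + by apply: filterS YW => w /= -> _; rewrite ger0_norm.
have t0 := le_trans s0 st; have [saF _ _] := fF.
pose A1 := A `&` [set w | (tau w <= s%:E)%E].
pose A2 := A `&` [set w | (s%:E < tau w)%E].
have FA1 : F s A1 by apply: (sigma_algebra_setI (saF _ s0)) (tauF _ s0).
have FA2 : F s A2.
  by apply: (sigma_algebra_setI (saF _ s0)) => //; apply: stopping_time_gt.
have mA1 := filtration_measurable _ _ _ fF s0 FA1.
have mA2 := filtration_measurable _ _ _ fF s0 FA2.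
have AE : A = A1 `|` A2.
  apply/seteqP; split => [w Aw|w [[]//|[]//]].
  by have [?|?] := leP (tau w) s%:E; [left|right].
have disj : [disjoint A1 & A2].
  by apply/disj_setPS => w [[_ /= a] [_ /=]]; rewrite ltNge a.
rewrite AE !integral_setU//; [|exact: mY|exact: mY].
congr (_ + _)%E.
  apply: eq_integral => w; rewrite inE => -[_ /= ws].
  by rewrite /stopped -/(capped (tau w) _) -(capped_const _ _ _ ws st).
have sA2 : A2 `<=` [set w | (s%:E < tau w)%E] by move=> w [].
(* [A2] belongs to the sigma-algebra at [min tau r] for every [r >= s], so this one event serves at
   both [s] and [t]. *)
have YX r : s <= r -> (\int[Q]_(w in A2) (stopped Y tau r w)%:E =
    \int[Q]_(w in A2) (stopped X tau r w)%:E)%E.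
  move=> sr; have r0 := le_trans s0 sr; have [W [mW W0 YW intW]] := proj r r0.
  rewrite -intW; last exact: F_at_min FA2 sA2.
  apply: ae_eq_integral => //; first exact: mY.
    by apply: measurable_funTS; exact/measurable_EFinP.
  by apply: filterS YW => w -> _.
rewrite !YX//; apply: (bounded_stopped_local_martingale Q G X tau C s t A2) => //.
exact: FG.
Qed.
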